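(* Let $p\in(1,\infty)$ and let $\mu,\nu$ be Radon measures on $\mathbb{R}^N$ without common atoms. Assume that a kernel $K\in L^2_{\mathrm{loc}}(\mu\times\nu)$ is restrictedly $L^p$ bounded with restricted norm $C$. Then the integral operator $T$, $Tf(s)=\int K(s,t)f(t)\,d\mu(t)$ (defined for bounded compactly supported Borel $f$), is a bounded operator $L^p(\mu)\to L^p(\nu)$ with norm at most $2C$.
   Context: A kernel $K$ on $\mathbb{R}^N\times\mathbb{R}^N$ is restrictedly $L^p$ bounded (as a formal operator $L^p(\mu)\to L^p(\nu)$) if $\left|\int K(s,t)f(t)g(s)\,d\mu(t)\,d\nu(s)\right|\le C\|f\|_{L^p(\mu)}\|g\|_{L^{p'}(\nu)}$, $1/p+1/p'=1$, for all bounded Borel $f,g$ with compact supports satisfying $\operatorname{dist}(\operatorname{supp}f,\operatorname{supp}g)>0$; the least such $C$ is the restricted norm of $K$. *)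

(* Defs.v *)
From HB Require Import structures.
From mathcomp Require Import all_boot all_order all_algebra.
From mathcomp Require Import all_classical all_reals all_analysis measurable_realfun.
Set Implicit Arguments. Unset Strict Implicit. Unset Printing Implicit Defensive.
Import Order.TTheory GRing.Theory Num.Theory.
Import numFieldNormedType.Exports.
Local Open Scope classical_set_scope.
Local Open Scope ring_scope.

Definition RN (R : realType) (N : nat) : measurableType _ :=
  g_sigma_algebraType (@open 'rV[R]_N).

(* Radon measure on R^N: a Borel measure finite on compact sets
   (on R^N local finiteness implies regularity). *)
Definition radon (R : realType) (N : nat) (mu : {measure set RN R N -> \bar R}) :=
  forall A : set 'rV[R]_N, compact A -> (mu A < +oo)%E.

Definition no_common_atoms (R : realType) (N : nat)
    (mu nu : {measure set RN R N -> \bar R}) :=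
  ~ exists x : RN R N, (0 < mu [set x])%E /\ (0 < nu [set x])%E.

Definition supp (R : realType) (N : nat) (f : RN R N -> R) : set 'rV[R]_N :=
  closure [set x : 'rV[R]_N | f x != 0].

Definition bdd_borel_cpt (R : realType) (N : nat) (f : RN R N -> R) :=
  [/\ measurable_fun setT f, (exists M : R, forall x, `|f x| <= M)
    & compact (supp f)].

Definition pos_dist (R : realType) (N : nat) (A B : set 'rV[R]_N) :=
  exists2 d : R, 0 < d & forall x y, A x -> B y -> d <= `|x - y|.

Definition L2loc (R : realType) (N : nat)
    (mu : {sigma_finite_measure set RN R N -> \bar R})
    (nu : {measure set RN R N -> \bar R}) (K : RN R N -> RN R N -> R) :=
  measurable_fun setT (fun z : RN R N * RN R N => K z.1 z.2) /\
  forall A B : set 'rV[R]_N, compact A -> compact B ->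
    (\int[nu \x mu]_(z in (A `*` B : set (RN R N * RN R N)))
        ((K z.1 z.2) ^+ 2)%:E < +oo)%E.

Definition restrictedly_Lp_bounded (R : realType) (N : nat) (p : R)
    (mu nu : {measure set RN R N -> \bar R}) (K : RN R N -> RN R N -> R) (C : R) :=
  forall f g : RN R N -> R, bdd_borel_cpt f -> bdd_borel_cpt g ->
    pos_dist (supp f) (supp g) ->
    (`| \int[nu]_s \int[mu]_t (K s t * f t * g s)%:E |
       <= C%:E * 'N[mu]_(p%:E)[EFin \o f] * 'N[nu]_((p / (p - 1))%:E)[EFin \o g])%E.

Definition intop (R : realType) (N : nat) (mu : {measure set RN R N -> \bar R})
    (K : RN R N -> RN R N -> R) (f : RN R N -> R) : RN R N -> \bar R :=
  fun s => (\int[mu]_t (K s t * f t)%:E)%E.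

(* Main.v *)
(* Split space into finitely many pairwise separated cells and put each cell
   independently, with probability 1/2, into E or into its complement F. For s and
   t in distinct cells, t is in E and s in F with probability 1/4, so averaging the
   restricted bound over the pairs (f 1_E, g 1_F) gives 1/4 of the form off the
   diagonal cells on the left. On the right, Hölder's inequality for the average gives
   C (1/2)^(1/p) (1/2)^(1/p') ||f|| ||g|| = C/2 ||f|| ||g||, whence the constant 2C. The
   cells are cut out by finitely many hyperplanes x_j = a, with a slab a - d < x_j < a
   removed to separate them. First d tends to 0 and then the hyperplanes become dense;
   the diagonal, which is null because there are no common atoms, is all that is lost.
   The bound on the operator follows by duality. *)
Require Import Defs.
From HB Require Import structures.
From mathcomp Require Import all_boot all_order all_algebra.
From mathcomp Require Import all_classical all_reals all_analysis measurable_realfun.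
From mathcomp Require Import ring lra zify.
Import Order.TTheory GRing.Theory Num.Theory.
Import numFieldNormedType.Exports.
Local Open Scope classical_set_scope.
Local Open Scope ring_scope.

(** * Counting subsets of a finite set; a finite Hölder inequality *)

(** The sets avoiding [x] are the subsets of its complement, which are half of all subsets. *)
Lemma sum_in_set (T : finType) (x : T) :
  (2 * \sum_(S : {set T}) (x \in S) = 2 ^ #|T|)%N.
Proof.
have T0 : (0 < #|T|)%N by apply/card_gt0P; exists x.
have h : (\sum_(S : {set T}) (x \notin S) = 2 ^ #|T|.-1)%N.
  rewrite -(cardsC1 x) -(card_powerset [set~ x]%SET) -sum1_card [RHS]big_mkcond /=.
  apply: eq_bigr => S _; rewrite powersetE finset.subsetC finset.sub1set inE.
  by case: (x \in S).
have : (\sum_(S : {set T}) (x \in S) + \sum_(S : {set T}) (x \notin S) = 2 ^ #|T|)%N.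
  rewrite -big_split /= (eq_bigr (fun=> 1%N)) => [|S _]; last by case: (x \in S).
  by rewrite sum1_card -cardsT -powersetT card_powerset cardsT.
rewrite h -{2 3}(prednK T0) expnS; lia.
Qed.

Lemma sum_notin_set (T : finType) (x : T) :
  (2 * \sum_(S : {set T}) (x \notin S) = 2 ^ #|T|)%N.
Proof.
rewrite -(sum_in_set _ x) [in LHS](reindex_inj (@finset.setC_inj T)).
by congr (_ * _)%N; apply: eq_bigr => S _; rewrite inE negbK.
Qed.

(** The sets avoiding both points are a quarter of all; removing them from the half that avoids [y]
    leaves a quarter. *)
Lemma sum_in_notin_set (T : finType) (x y : T) : x != y ->
  (4 * \sum_(S : {set T}) (x \in S) && (y \notin S) = 2 ^ #|T|)%N.
Proof.
move=> xy.
have h : (4 * \sum_(S : {set T}) (x \notin S) && (y \notin S) = 2 ^ #|T|)%N.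
  have <- : (#|(~: [set x; y])%SET| + 2 = #|T|)%N.
    by rewrite -(cardsC [set x; y]%SET) cards2 xy addnC.
  rewrite expnD mulnC; congr (_ * _)%N.
  rewrite -(card_powerset (~: [set x; y])%SET) -sum1_card [RHS]big_mkcond /=.
  apply: eq_bigr => S _; rewrite powersetE finset.subsetC.
  rewrite finset.subUset !finset.sub1set !inE.
  by case: (x \in S); case: (y \in S).
have h3 : (\sum_(S : {set T}) (x \in S) && (y \notin S) +
  \sum_(S : {set T}) (x \notin S) && (y \notin S) = \sum_(S : {set T}) (y \notin S))%N.
  rewrite -big_split /=; apply: eq_bigr => S _.
  by case: (x \in S); case: (y \in S).
have := sum_notin_set _ y; lia.
Qed.

(** Young's inequality for [a i / A] and [b i / B], summed over [i]. The common factor [M] survives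
    to the first power because 1/p + 1/q = 1. *)
Lemma sum_hoelder (R : realType) (I : finType) (p q A B M : R) (a b : I -> R) :
  0 < p -> 0 < q -> p^-1 + q^-1 = 1 -> 0 <= A -> 0 <= B -> 0 <= M ->
  (forall i, 0 <= a i) -> (forall i, 0 <= b i) ->
  \sum_i a i `^ p <= M * A `^ p -> \sum_i b i `^ q <= M * B `^ q ->
  \sum_i a i * b i <= M * A * B.
Proof.
move=> p0 q0 pq A0 B0 M0 a0 b0 ha hb.
(* Young's inequality divides by [A] and [B]. If one of them is 0, its hypothesis forces every term
   of its family to vanish. *)
have vanish (r X : R) (x : I -> R) : 0 < r -> X = 0 -> (forall i, 0 <= x i) ->
    \sum_i x i `^ r <= M * X `^ r -> forall i, x i = 0.
  move=> r0 -> x0; rewrite powR0 ?gt_eqF// mulr0 => hx i.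
  have /eqP : \sum_i x i `^ r = 0.
    by apply/eqP; rewrite eq_le hx sumr_ge0// => j _; rewrite powR_ge0.
  rewrite psumr_eq0; last by move=> j _; rewrite powR_ge0.
  by move=> /allP /(_ i); rewrite mem_index_enum => /(_ isT) /eqP /powR_eq0_eq0.
have [A00|An0] := eqVneq A 0.
  rewrite big1 ?mulr_ge0// => i _.
  by rewrite (vanish _ _ _ p0 A00 a0 ha) mul0r.
have [B00|Bn0] := eqVneq B 0.
  rewrite big1 ?mulr_ge0// => i _.
  by rewrite (vanish _ _ _ q0 B00 b0 hb) mulr0.
have {}A0 : 0 < A by rewrite lt_neqAle eq_sym An0.
have {}B0 : 0 < B by rewrite lt_neqAle eq_sym Bn0.
have young i : a i * b i <=
    A * B * (a i `^ p / (A `^ p * p) + b i `^ q / (B `^ q * q)).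
  have := @conjugate_powR R (a i / A) (b i / B) p q
    (divr_ge0 (a0 i) (ltW A0)) (divr_ge0 (b0 i) (ltW B0)) p0 q0 pq.
  rewrite !powRM ?invr_ge0 ?(ltW A0) ?(ltW B0)//.
  rewrite -(ler_pM2l (mulr_gt0 A0 B0)) => h.
  have -> : a i * b i = A * B * (a i / A * (b i / B)) by field; rewrite An0 Bn0.
  apply: le_trans h _.
  have powRV (X r : R) : 0 < X -> X^-1 `^ r = (X `^ r)^-1.
    by move=> X0; rewrite -powR_inv1 ?(ltW X0)// -powRrM mulN1r powRN.
  by rewrite !powRV// !invfM !mulrA.
apply: le_trans (ler_sum _ (fun i _ => young i)) _.
have h1 : (\sum_i a i `^ p) / (A `^ p * p) <= M / p.
  by rewrite ler_pdivrMr ?mulr_gt0 ?powR_gt0// [leRHS](_ : _ = M * A `^ p)//;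
     field; rewrite gt_eqF.
have h2 : (\sum_i b i `^ q) / (B `^ q * q) <= M / q.
  by rewrite ler_pdivrMr ?mulr_gt0 ?powR_gt0// [leRHS](_ : _ = M * B `^ q)//;
     field; rewrite gt_eqF.
rewrite -mulr_sumr big_split /= -!mulr_suml.
have -> : M * A * B = A * B * (M / p + M / q) by rewrite -mulrDr pq; ring.
by rewrite ler_pM2l ?mulr_gt0// lerD.
Qed.

(** * Boxes, hyperplane cells and removed slabs in $\mathbb{R}^N$ *)

Section euclidean_borel.
Context {R : realType} {N : nat}.
Local Notation E := (RN R N).
Implicit Types (A : set 'rV[R]_N) (x y : 'rV[R]_N).

Lemma measurable_open_RN A : open A -> measurable (A : set E).
Proof. exact: sub_sigma_algebra. Qed.

Lemma measurable_closed_RN A : closed A -> measurable (A : set E).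
Proof.
move=> cA; rewrite -(setCK A); apply: measurableC.
by apply: measurable_open_RN; exact: closed_openC.
Qed.

Lemma measurable_compact_RN A : compact A -> measurable (A : set E).
Proof.
by move=> cA; apply: measurable_closed_RN; apply: compact_closed => //; exact: norm_hausdorff.
Qed.

Lemma measurable_set1_RN (x : E) : measurable [set x].
Proof. by apply: measurable_compact_RN; exact: compact_set1. Qed.

Lemma measurable_coord (j : 'I_N) :
  measurable_fun setT (fun x : E => (x : 'rV[R]_N) ord0 j).
Proof.
move=> _; apply: (measurability _ (RGenOpens.measurableE R)) => //.
move=> _ [_ [a [b ->] <-]]; rewrite setTI.
apply: measurable_open_RN; apply: open_comp; last exact: interval_open.
by move=> x _; exact: coord_continuous.
Qed.

Lemma le_coord_norm x j : `|x ord0 j| <= `|x|.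
Proof.
have /mapP[i Hi ->] : `|x ord0 j| \in [seq `|x u.1 u.2| | u : 'I_1 * 'I_N].
  by apply/mapP; exists (ord0, j) => //=; rewrite mem_enum.
by rewrite [leRHS]/Num.norm /= mx_normrE; apply/bigmax_geP; right => /=; exists i.
Qed.

(** The closed ball of the maximum norm, given by coordinates so that it is compact as a product of
    segments. *)
Definition box (M : R) : set 'rV[R]_N := [set x | forall j, `|x ord0 j| <= M].

Lemma compact_box M : compact (box M).
Proof.
rewrite (_ : box M = [set x | forall j, `[- M, M]%classic (x ord0 j)]).
  by apply: (@rV_compact _ _ (fun=> `[- M, M]%classic)) => j; exact: segment_compact.
by apply/seteqP; split=> x /= h j; have := h j; rewrite ler_norml in_itv.
Qed.

Lemma box_cover x : exists n0, forall n, (n0 <= n)%N -> box n%:R x.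
Proof.
exists (Num.trunc `|x|).+1 => n n0n j; apply: le_trans (le_coord_norm x j) _.
by apply: le_trans (ltW (truncnS_gt _)) _; rewrite ler_nat.
Qed.

(** An enumeration of the rationals: [q] occurs at index [pickle q], and indices that code no
    rational get the default 0. *)
Definition threshold (i : nat) : R := if unpickle i is Some q then ratr q else 0.

(** The label of the cell of [x]: its side of each hyperplane given by the first [n] thresholds in
    each coordinate. Labels form a finite type, whose subsets can be averaged over. *)
Definition cell n (x : E) : {ffun 'I_N * 'I_n -> bool} :=
  [ffun u : 'I_N * 'I_n => (x : 'rV[R]_N) ord0 u.1 < threshold u.2].

(** What is left after removing an open slab just below each hyperplane. As [cell] tests a strict
    inequality, points on a hyperplane belong to the upper side and are kept, so the slabs shrink to
    the empty set as [k] grows. *)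
Definition gapped n k : set E :=
  [set x : 'rV[R]_N | forall u : 'I_N * 'I_n,
    ~~ (threshold u.2 - k.+1%:R^-1 < x ord0 u.1 < threshold u.2)].

Lemma measurable_cell n (P : pred {ffun 'I_N * 'I_n -> bool}) :
  measurable [set x : E | P (cell n x)].
Proof.
rewrite (_ : mkset _ = \bigcup_(v in [set v | P v]) \bigcap_(u in [set: 'I_N * 'I_n])
    [set x : E | ((x : 'rV[R]_N) ord0 u.1 < threshold u.2) == v u]).
  apply: fin_bigcup_measurable; first exact: finite_finset.
  move=> v _; apply: fin_bigcap_measurable; first exact: finite_finset.
  move=> u _.
  have m : measurable_fun setT (fun x : E => (x : 'rV[R]_N) ord0 u.1 < threshold u.2).
    by apply: measurable_fun_ltr => //; exact: measurable_coord.
  rewrite -[mkset _]setTI; apply: (m measurableT [set b | b == v u]) => //.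
apply/seteqP; split=> [x Px|x [v Pv h]] /=.
  by exists (cell n x) => // u _ /=; rewrite ffunE.
by rewrite (_ : cell n x = v)//; apply/ffunP => u; rewrite ffunE; apply/eqP/h.
Qed.

Lemma measurable_gapped n k : measurable (gapped n k).
Proof.
rewrite (_ : gapped n k = \bigcap_(u in [set: 'I_N * 'I_n])
    [set x : E | ~~ (threshold u.2 - k.+1%:R^-1 < (x : 'rV[R]_N) ord0 u.1 < threshold u.2)]).
  apply: fin_bigcap_measurable; first exact: finite_finset.
  move=> u _.
  have m : measurable_fun setT (fun x : E => ~~ (threshold u.2 - k.+1%:R^-1 <
      (x : 'rV[R]_N) ord0 u.1 < threshold u.2)).
    apply: measurable_neg; apply: measurable_and; apply: measurable_fun_ltr => //;
    exact: measurable_coord.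
  by rewrite -[mkset _]setTI; exact: (m measurableT [set true]).
by apply/seteqP; split=> [x h u _|x h u]; apply: h.
Qed.

(** Some hyperplane $x_j = a$ has the points on different sides. The upper one has $j$-th coordinate
    at least $a$ and the lower one, being outside the slab, at most $a - d$ with $d = 1/(k+1)$. *)
Lemma gapped_dist n k x y : gapped n k x -> gapped n k y -> cell n x != cell n y ->
  k.+1%:R^-1 <= `|x - y|.
Proof.
move=> Gx Gy xy.
have [u] : exists u, cell n x u != cell n y u.
  by apply/existsP; apply: contraNT xy; rewrite negb_exists => /forallP h;
     apply/eqP/ffunP => u; have /negPn/eqP := h u.
rewrite !ffunE => xyu.
apply: le_trans (le_coord_norm _ u.1); rewrite !mxE.
have d0 : 0 < k.+1%:R^-1 :> R by rewrite invr_gt0.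
move: (Gx u) (Gy u) xyu d0; move: (k.+1%:R^-1 : R) => d + + + d0.
move: (x ord0 u.1) (y ord0 u.1) (threshold u.2) => a b c.
case: (ltP a c); case: (ltP b c) => //= h1 h2.
  by rewrite andbF andbT -leNgt => h3 _ _; rewrite distrC ger0_norm; lra.
by rewrite andbF andbT -leNgt => _ h3 _; rewrite ger0_norm; lra.
Qed.

(** Only finitely many hyperplanes are involved, and a point strictly below one of them leaves its
    slab once the width is less than its distance to it. *)
Lemma near_gapped n x : \forall k \near \oo, gapped n k x.
Proof.
apply: filter_forall => u.
have [h|h] := ltP (x ord0 u.1) (threshold u.2); last first.
  by apply: nearW => k; rewrite andbF.
have d0 : 0 < threshold u.2 - x ord0 u.1 by rewrite subr_gt0.
near=> k; rewrite andbT -leNgt.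
have : k.+1%:R^-1 < threshold u.2 - x ord0 u.1.
  by near: k; exact: near_infty_natSinv_lt (PosNum d0).
by rewrite ltrBrDr addrC -ltrBrDr => /ltW.
Unshelve. all: by end_near. Qed.

(** A rational strictly between two differing coordinates is a threshold that tells the points
    apart. *)
Lemma near_cell_neq x y : x != y -> \forall n \near \oo, cell n x != cell n y.
Proof.
move=> xy.
have [j xyj] : exists j, x ord0 j != y ord0 j.
  by apply/existsP; apply: contraNT xy; rewrite negb_exists => /forallP h;
     apply/eqP/rowP => j; have /negPn/eqP := h j.
wlog lt_xy : x y {xy xyj} / x ord0 j < y ord0 j => [hw|].
  have /orP[l|l] : (x ord0 j < y ord0 j) || (y ord0 j < x ord0 j) by rewrite -neq_lt.
    exact: hw.
  by apply: filterS (hw _ _ l) => n; rewrite eq_sym.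
have [q] := rat_in_itvoo lt_xy; rewrite in_itv/= => /andP[xq qy].
(* Level [n] tests the indices below [n], hence the successor. *)
exists (pickle q).+1 => // n /= qn.
apply/eqP => /ffunP /(_ (j, Ordinal qn)).
by rewrite !ffunE /threshold /= pickleK xq => /esym; rewrite ltNge (ltW qy).
Qed.

End euclidean_borel.

(** * Test functions and their norms *)

Section test_functions.
Context {R : realType} {N : nat}.
Local Notation E := (RN R N).
Implicit Types (A B : set 'rV[R]_N) (f g : E -> R).

(** The same [d] serves: points of the closures closer than [d] could each be approximated to within
    half the deficit, giving points of [A] and [B] closer than [d]. Supports are closures, so
    separation of the cells has to pass to them. *)
Lemma pos_dist_closure A B : pos_dist A B -> pos_dist (closure A) (closure B).
Proof.
move=> [d d0 dAB]; exists d => // x y cAx cBy.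
rewrite leNgt; apply/negP => xyd.
have e0 : 0 < (d - `|x - y|) / 2 by rewrite divr_gt0// subr_gt0.
have [a [Aa /=]] := cAx _ (nbhsx_ballx x _ e0).
have [b [Bb /=]] := cBy _ (nbhsx_ballx y _ e0).
rewrite -!ball_normE /= => yb xa.
have := dAB a b Aa Bb; rewrite leNgt => /negP; apply.
have -> : a - b = (a - x) + (x - y) + (y - b) by rewrite !addrA !subrK.
apply: le_lt_trans (ler_normD _ _) _.
rewrite [ltRHS](_ : d = ((d - `|x - y|) / 2 + `|x - y|) + (d - `|x - y|) / 2); last by field.
rewrite ltrD//; apply: le_lt_trans (ler_normD _ _) _.
by rewrite ltrD2r distrC.
Qed.

Lemma supp_eq0 f x : ~ supp f x -> f x = 0.
Proof. by move=> fx; apply/eqP/negPn/negP => fx0; apply: fx; exact: subset_closure. Qed.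

Lemma supp_restrict f (A : set E) : supp (fun x => f x * \1_A x) `<=` supp f `&` closure A.
Proof.
apply: subset_trans (@closureI _ _ _); apply: closure_subset => x /=.
by rewrite mulf_eq0 negb_or => /andP[-> ]; rewrite indicE pnatr_eq0 eqb0 negbK inE.
Qed.

Lemma bdd_borel_cpt_restrict f (A : set E) : measurable A -> bdd_borel_cpt f ->
  bdd_borel_cpt (fun x => f x * \1_A x).
Proof.
move=> mA [mf [M fM] cf]; split.
- by apply: measurable_funM => //; exact: measurable_indic.
- exists M => x; rewrite normrM; apply: le_trans (fM x).
  by rewrite ler_piMr// indicE; case: (x \in A); rewrite ?normr1 ?normr0.
- apply: subclosed_compact cf _; first exact: closed_closure.
  by apply: subset_trans (supp_restrict _ _) _; exact: subIsetl.
Qed.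

Lemma bdd_borel_cpt_sub_box f (M b : R) : measurable_fun setT f ->
  (forall x, `|f x| <= M) -> (forall x, f x != 0 -> box b x) -> bdd_borel_cpt f.
Proof.
move=> mf fM fB; split => //; first by exists M.
apply: subclosed_compact (@compact_box R N b) _; first exact: closed_closure.
rewrite /supp closureE; apply: smallest_sub fB.
by apply: compact_closed (@compact_box R N b); exact: norm_hausdorff.
Qed.

Variable m : {measure set E -> \bar R}.
Hypothesis rm : radon m.

Lemma Lnorm_fin_num f (r : R) : 0 < r -> bdd_borel_cpt f ->
  'N[m]_(r%:E)[EFin \o f]%E \is a fin_num.
Proof.
move=> r0 [mf [M fM] cf].
have mS := measurable_compact_RN _ cf.
rewrite unlock fin_num_poweR// ge0_fin_numE; last first.
  by apply: integral_ge0 => x _; rewrite poweR_ge0.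
have mfr : measurable_fun setT (fun x => (`|f x| `^ r)%:E).
  apply/measurable_EFinP; apply: (measurableT_comp (measurable_powR r)).
  exact: measurableT_comp.
(* The integrand vanishes off the support because [0 < r]; zero to the power zero would be 1. *)
rewrite (_ : (\int[m]_x _)%E = (\int[m]_(x in supp f) (`|f x| `^ r)%:E)%E); last first.
  rewrite [RHS]integral_mkcond; apply: eq_integral => x _ /=.
  rewrite patchE; case: ifPn => // /negP; rewrite inE => /supp_eq0 ->.
  by rewrite normr0 powR0 ?gt_eqF.
apply: (@le_lt_trans _ _ (\int[m]_(x in supp f) (M `^ r)%:E)%E).
  apply: ge0_le_integral => //=.

  - exact: measurable_funTS.
  - by move=> x _; rewrite lee_fin ge0_ler_powR ?(ltW r0)// nnegrE// (le_trans _ (fM x)).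
by rewrite integral_cst// lte_mul_pinfty// ?lee_fin ?powR_ge0//; exact: rm.
Qed.

(** The [r]-th powers of the norms are integrals, and at each [x] the integrands add up to
    $|f(x)|^r$ times the number of sets [A i] containing [x]. *)
Lemma sum_Lnorm_restrict f (r M : R) (I : finType) (A : I -> set E) :
  0 < r -> 0 <= M -> bdd_borel_cpt f -> (forall i, measurable (A i)) ->
  (forall x, \sum_i \1_(A i) x <= M) ->
  \sum_i fine 'N[m]_(r%:E)[EFin \o (fun x => f x * \1_(A i) x)] `^ r <=
    M * fine 'N[m]_(r%:E)[EFin \o f] `^ r.
Proof.
move=> r0 M0 bf mA AM.
have rn0 : r != 0 by rewrite gt_eqF.
have fE g : bdd_borel_cpt g ->
    ((fine 'N[m]_(r%:E)[EFin \o g] `^ r)%:E = \int[m]_x (`|g x| `^ r)%:E)%E.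
  move=> bg; rewrite -poweR_EFin fineK ?Lnorm_fin_num// poweR_Lnorm//.
have mr g : measurable_fun setT g -> measurable_fun setT (fun x : E => (`|g x| `^ r)%:E).
  move=> mg; apply/measurable_EFinP; apply: (measurableT_comp (measurable_powR r)).
  exact: measurableT_comp.
have bfA i := bdd_borel_cpt_restrict _ _ (mA i) bf.
rewrite -lee_fin EFinM -sumEFin fE//.
under eq_bigr do rewrite fE//.
rewrite -ge0_integral_sum//; last by move=> i; apply: mr; have [] := bfA i.
have mf : measurable_fun setT f by have [] := bf.
rewrite -ge0_integralZl_EFin//; last exact: mr.
apply: ge0_le_integral => //.
- by move=> x _; apply: sume_ge0 => i _; rewrite lee_fin powR_ge0.
- by apply: emeasurable_sum => i; apply: mr; have [] := bfA i.
- by apply: measurable_funeM; exact: mr.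
move=> x _; rewrite sumEFin -EFinM lee_fin.
apply: (@le_trans _ _ (\sum_i \1_(A i) x * `|f x| `^ r)).
  apply: ler_sum => i _; rewrite normrM powRM// indicE.
  by case: (x \in A i); rewrite /= ?normr1 ?powR1 ?normr0 ?powR0 ?mulr1 ?mulr0 ?mul1r ?mul0r.
by rewrite -mulr_suml ler_wpM2r ?powR_ge0.
Qed.

End test_functions.

(** * Atoms of Radon measures and the diagonal *)

Lemma set_mem_cons (T : eqType) (x : T) (s : seq T) :
  [set` x :: s] = [set x] `|` [set` s].
Proof.
apply/seteqP; split=> y /=; rewrite inE; first by case/predU1P; [left|right].
by case=> [->|->]; rewrite ?eqxx ?orbT.
Qed.

Section atoms.
Context {R : realType} {N : nat}.
Local Notation E := (RN R N).

Lemma measurable_seq_RN (s : seq E) : measurable [set` s].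
Proof.
elim: s => [|x s ih]; first by rewrite classical_sets.set_nil.
by rewrite set_mem_cons; apply: measurableU => //; exact: measurable_set1_RN.
Qed.

Lemma ge_measure_seq (m : {measure set E -> \bar R}) (e : R) (s : seq E) :
  uniq s -> (forall x, x \in s -> (e%:E <= m [set x])%E) ->
  (((size s)%:R * e)%:E <= m [set` s])%E.
Proof.
elim: s => [_ _|x s ih /= /andP[xs us] h].
  by rewrite mul0r classical_sets.set_nil measure0.
rewrite set_mem_cons measureU//; first last.
- by apply/seteqP; split=> // y [/= -> /=]; rewrite (negbTE xs).
- exact: measurable_seq_RN.
- exact: measurable_set1_RN.
rewrite -natr1 mulrDl mul1r addrC EFinD leeD//; first by apply: h; rewrite mem_head.
by apply: ih => // y ys; apply: h; rewrite inE ys orbT.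
Qed.

Lemma measure_seq_eq0 (m : {measure set E -> \bar R}) (s : seq E) :
  (forall x, x \in s -> m [set x] = 0)%E -> m [set` s] = 0%E.
Proof.
elim: s => [_|x s ih h]; first by rewrite classical_sets.set_nil measure0.
rewrite set_mem_cons; apply/eqP; rewrite -measure_le0.
apply: (@le_trans _ _ (m [set x] + m [set` s])%E).
  by apply: measureU2; [exact: measurable_set1_RN|exact: measurable_seq_RN].
rewrite h ?mem_head// ih ?addr0 ?adde0// => y ys.
by apply: h; rewrite inE ys orbT.
Qed.

(** Otherwise [A] would contain more than [m A / e] points of mass at least [e], and their total
    mass would exceed the finite [m A]. *)
Lemma finite_large_atoms (m : {measure set E -> \bar R}) (A : set 'rV[R]_N) (e : R) :
  radon m -> compact A -> 0 < e -> finite_set [set x : E | A x /\ (e%:E <= m [set x])%E].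
Proof.
move=> rm cA e0; apply: contrapT => inf.
have mA := rm _ cA; have mmA : measurable (A : set E) := measurable_compact_RN _ cA.
have [B BA Bn] := infinite_set_fset (Num.trunc (fine (m A) / e)).+1 inf.
have : (((size (finmap.enum_fset B))%:R * e)%:E <= m A)%E.
  apply: le_trans (ge_measure_seq m e (finmap.enum_fset B) (finmap.fset_uniq B) _) _.
    by move=> x /BA[].
  apply: le_measure; rewrite ?inE//; first exact: measurable_seq_RN.
  by move=> x /BA[].
apply/negP; rewrite -ltNge -(@fineK _ (m A)) ?ge0_fin_numE// lte_fin -ltr_pdivrMr//.
by apply: lt_le_trans (truncnS_gt _) _; rewrite ler_nat.
Qed.

(** The atoms of [mu] are countable: those in a given box with mass at least $1/(k+1)$ are finitely
    many. None of them is charged by [nu]. *)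
Lemma negligible_atoms (mu nu : {measure set E -> \bar R}) :
  radon mu -> no_common_atoms mu nu -> nu.-negligible [set x | (0 < mu [set x])%E].
Proof.
move=> rmu nca.
pose S (n k : nat) := [set x : E | box n%:R x /\ ((k.+1%:R^-1)%:E <= mu [set x])%E].
apply: (@negligibleS _ _ _ _ (\bigcup_n \bigcup_k S n k)).
  move=> x /= mux; have [n0 /(_ n0 (leqnn _)) xn] := box_cover x.
  exists n0 => //.
  have [r r0 rmux] : exists2 r : R, 0 < r & (r%:E <= mu [set x])%E.
    case: (mu [set x]) mux => [r||]//; first by exists r.
    by move=> _; exists 1; rewrite ?leey.
  exists (Num.trunc r^-1) => //; split => //; apply: le_trans rmux.
  rewrite lee_fin -[leRHS]invrK lef_pV2 ?posrE ?invr_gt0//.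
  exact/ltW/truncnS_gt.
apply: negligible_bigcup => n; apply: negligible_bigcup => k.
have /finite_seqP[s Ss] : finite_set (S n k).
  by apply: finite_large_atoms => //; exact: compact_box.
rewrite Ss; apply/negligibleP; first exact: measurable_seq_RN.
apply: measure_seq_eq0 => x xs; apply: contrapT => /eqP nux; apply: nca.
exists x; split; last by rewrite lt_neqAle eq_sym nux measure_ge0.
have [_] : S n k x by rewrite Ss.
by apply: lt_le_trans; rewrite lte_fin invr_gt0.
Qed.

Lemma measurable_diagonal : measurable [set z : E * E | z.1 = z.2].
Proof.
rewrite (_ : mkset _ = \bigcap_(j in [set: 'I_N]) [set z : E * E |
    (z.1 : 'rV[R]_N) ord0 j == (z.2 : 'rV[R]_N) ord0 j]).
  apply: fin_bigcap_measurable; first exact: finite_finset.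
  move=> j _.
  have m : measurable_fun setT (fun z : E * E =>
      (z.1 : 'rV[R]_N) ord0 j == (z.2 : 'rV[R]_N) ord0 j).
    by apply: measurable_fun_eqr; exact: (measurableT_comp (measurable_coord j)).
  by rewrite -[mkset _]setTI; exact: (m measurableT [set true]).
apply/seteqP; split=> [z /= zz j _ /=|z h /=].
  by rewrite zz.
by apply/rowP => j; apply/eqP/h.
Qed.

(** The section of the diagonal at [x] is the singleton of [x], so the measure is the [nu]-integral
    of [mu [set x]], which is zero off the atoms of [mu]. *)
Lemma diagonal_null (mu : {sigma_finite_measure set E -> \bar R})
    (nu : {measure set E -> \bar R}) : radon mu -> no_common_atoms mu nu ->
  (nu \x mu)%E [set z : E * E | z.1 = z.2] = 0%E.
Proof.
move=> rmu nca; rewrite /= /product_measure1.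
transitivity (\int[nu]_x (cst 0 x : \bar R))%E; last exact: integral0.
apply: ge0_ae_eq_integral => //.
- exact: measurable_fun_xsection measurable_diagonal.
apply: negligibleS (negligible_atoms _ _ rmu nca) => x /=.
rewrite (_ : xsection _ x = [set x]); last first.
  by apply/seteqP; split=> y /=; rewrite /xsection/= inE/=.
by move=> h; rewrite lt_neqAle measure_ge0 andbT; apply: contra_not_neq h => <-.
Qed.

End atoms.

(** * Sigma-finiteness of Radon measures *)

(** The work on product measures below takes both measures with a bundled sigma-finite structure,
    whereas [nu] comes without one. Repacking the same set function gives an equality of measures
    along which everything can be rewritten. *)
Lemma sigma_finite_measure_of (d : measure_display) (T : measurableType d) (R : realType)
    (m : {measure set T -> \bar R}) : sigma_finite setT m ->
  exists m' : {sigma_finite_measure set T -> \bar R}, (m' : {measure set T -> \bar R}) = m.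
Proof.
case: m => m [c1 c2] sf.
pose M : {measure set T -> \bar R} := Measure.Pack (@Measure.Class _ _ _ m c1 c2).
have sfM : sigma_finite setT M by [].
pose i := Measure_isSigmaFinite.Build d T R M sfM.
by exists (HB.pack (Measure.sort M) i : {sigma_finite_measure set T -> \bar R}).
Qed.

Lemma radon_sigma_finite (R : realType) (N : nat) (m : {measure set RN R N -> \bar R}) :
  radon m -> sigma_finite setT m.
Proof.
move=> rm; exists (fun n => @box R N n%:R).
  apply/seteqP; split=> // x _; have [n0 /(_ n0 (leqnn _)) xn] := box_cover x.
  by exists n0.
move=> n; split; last exact/rm/compact_box.
by apply: measurable_compact_RN; exact: compact_box.
Qed.

(** * The kernel form on test functions: integrability and limits *)

Section kernel.
Context {R : realType} {N : nat}.
Local Notation E := (RN R N).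
Variables (mu nu : {sigma_finite_measure set E -> \bar R}) (K : E -> E -> R).
Hypotheses (rmu : radon mu) (rnu : radon nu) (KL2 : L2loc mu nu K).
Implicit Types (f g : E -> R) (w : E * E -> R).
Local Notation P := (nu \x mu)%E.

(** Local square integrability gives local integrability: on [A] times [B], a set of finite measure,
    the integrand is dominated by $M(K^2 + 1)$. *)
Lemma integrable_kernel (h : E * E -> R) (M : R) (A B : set 'rV[R]_N) :
  compact A -> compact B -> measurable_fun setT h -> (forall z, `|h z| <= M) ->
  (forall z, ~ (A `*` B) z -> h z = 0) ->
  P.-integrable setT (fun z => (K z.1 z.2 * h z)%:E).
Proof.
move=> cA cB mh hM h0; have [mK K2] := KL2.
have mA : measurable (A : set E) := measurable_compact_RN _ cA.
have mB : measurable (B : set E) := measurable_compact_RN _ cB.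
pose D : set (E * E) := A `*` B.
have mD : measurable D by exact: measurableX.
have M0 : 0 <= M by apply: le_trans (hM (0 : 'rV[R]_N, 0 : 'rV[R]_N)).
have PD : (P D < +oo)%E.
  by rewrite product_measure1E// lte_mul_pinfty ?rmu ?rnu// ge0_fin_numE// rnu.
have mKh : measurable_fun setT (fun z : E * E => (K z.1 z.2 * h z)%:E).
  by apply/measurable_EFinP; exact: measurable_funM.
have mK2 : measurable_fun setT (fun z : E * E => K z.1 z.2 ^+ 2).
  exact: measurable_funX.
have i1 : P.-integrable D (fun z => (K z.1 z.2 ^+ 2)%:E).
  apply/integrableP; split.
    by apply/measurable_EFinP; exact: measurable_funTS.
  under eq_integral do rewrite gee0_abs ?lee_fin ?sqr_ge0//.
  exact: K2.
have i2 : P.-integrable D (cst 1%:E).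
  apply/integrableP; split => //.
  by under eq_integral do rewrite abse1; rewrite integral_cst// mul1e.
have i3 := integrableZl mD M (integrableD mD i1 i2).
have : P.-integrable D (fun z => (K z.1 z.2 * h z)%:E).
  apply: le_integrable i3 => //; first exact: measurable_funTS.
  move=> z _ /=; rewrite lee_fin normrM [leRHS]ger0_norm; last first.
    by rewrite mulr_ge0// addr_ge0// sqr_ge0.
  rewrite mulrC ler_pM//.
  (* Expanding $(|K| - 1)^2 \ge 0$ gives $2|K| \le K^2 + 1$. *)
  rewrite -[K _ _ ^+ 2]real_normK ?num_real//.
  have := sqr_ge0 (`|K z.1 z.2| - 1); have := normr_ge0 (K z.1 z.2).
  by move: `|_| => a; nra.
move/(integrable_mkcond _ mD); apply: eq_integrable => // z _ /=.
by rewrite patchE; case: ifPn => // /negP; rewrite inE => /h0 ->; rewrite mulr0.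
Qed.

Lemma integrable_kernel_test f g : bdd_borel_cpt f -> bdd_borel_cpt g ->
  P.-integrable setT (fun z => (K z.1 z.2 * f z.2 * g z.1)%:E).
Proof.
move=> [mf [M fM] cf] [mg [M' gM'] cg].
under eq_fun do rewrite -mulrA.
apply: (integrable_kernel (fun z => f z.2 * g z.1) (M * M') (supp g) (supp f)) => //.
- by apply: measurable_funM; [exact: (measurableT_comp mf)|exact: (measurableT_comp mg)].
- by move=> z; rewrite normrM ler_pM.
- move=> z /= /not_andP[/supp_eq0 ->|/supp_eq0 ->]; first by rewrite mulr0.
  by rewrite mul0r.
Qed.

Lemma iterated_kernel_test f g : bdd_borel_cpt f -> bdd_borel_cpt g ->
  (\int[nu]_s \int[mu]_t (K s t * f t * g s)%:E =
   \int[P]_z (K z.1 z.2 * f z.2 * g z.1)%:E)%E.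
Proof.
by move=> bf bg; rewrite -integral12_prod_meas1//; exact: integrable_kernel_test.
Qed.

(** Dominated convergence with majorant $|K f g|$. Convergence is asked as eventual equality, the
    form in which the 0-1 weights of slabs and cells stabilise. *)
Lemma kernel_bound_lim f g (w_ : nat -> E * E -> R) w (b : \bar R) :
  bdd_borel_cpt f -> bdd_borel_cpt g ->
  (forall n, measurable_fun setT (w_ n)) -> measurable_fun setT w ->
  (forall n z, `|w_ n z| <= 1) ->
  {ae P, forall z, \forall n \near \oo, w_ n z = w z} ->
  (forall n, `| \int[P]_z (K z.1 z.2 * f z.2 * g z.1 * w_ n z)%:E | <= b)%E ->
  (`| \int[P]_z (K z.1 z.2 * f z.2 * g z.1 * w z)%:E | <= b)%E.
Proof.
move=> bf bg mw_ mw w1 cw hb.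
have i0 := integrable_kernel_test _ _ bf bg.
have mH : measurable_fun setT (fun z : E * E => K z.1 z.2 * f z.2 * g z.1).
  by apply/measurable_EFinP; exact: measurable_int i0.
have mHw v : measurable_fun setT v ->
    measurable_fun setT (fun z : E * E => (K z.1 z.2 * f z.2 * g z.1 * v z)%:E).
  by move=> mv; apply/measurable_EFinP; exact: measurable_funM.
have cvg : (\int[P]_z (K z.1 z.2 * f z.2 * g z.1 * w_ n z)%:E)%E @[n --> \oo] -->
    (\int[P]_z (K z.1 z.2 * f z.2 * g z.1 * w z)%:E)%E.
  have [|||||//] := @dominated_convergence _ _ _ P setT measurableT
    (fun n z => (K z.1 z.2 * f z.2 * g z.1 * w_ n z)%:E)
    (fun z => (K z.1 z.2 * f z.2 * g z.1 * w z)%:E)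
    (abse \o (fun z => (K z.1 z.2 * f z.2 * g z.1)%:E)).
  - by move=> n; exact: mHw.
  - exact: mHw.
  - apply: filterS cw => z hz _; apply: cvg_near_cst.
    by apply: filterS hz => n ->.
  - exact: integrable_abse.
  - by apply: aeW => z n _ /=; rewrite lee_fin normrM ler_piMr.
by apply: cvge_le (cvg_abse cvg); exact: nearW.
Qed.

(** * Averaging the restricted bound over splittings of the cells *)

Variables (p C : R).
Hypotheses (nca : no_common_atoms mu nu) (p1 : 1 < p) (C0 : 0 <= C).
Hypothesis (KC : restrictedly_Lp_bounded p mu nu K C).
Let q := p / (p - 1).
Local Notation Nf f := ('N[mu]_(p%:E)[EFin \o f])%E.
Local Notation Ng g := ('N[nu]_(q%:E)[EFin \o g])%E.

(** The random splitting becomes a sum over all sets [S] of labels, [m] in number: [f] is kept on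
    the cells in [S] and [g] on the others, both inside [G]. *)
Lemma separated_cells_bound (T : finType) (c : E -> T) (G : set E) (d : R) f g :
  (forall S : {set T}, measurable [set x | c x \in S]) -> measurable G -> 0 < d ->
  (forall x y : 'rV[R]_N, G x -> G y -> c x != c y -> d <= `|x - y|) ->
  bdd_borel_cpt f -> bdd_borel_cpt g ->
  (`| \int[P]_z (K z.1 z.2 * f z.2 * g z.1 *
        (\1_G z.1 * \1_G z.2 * (c z.1 != c z.2)%:R))%:E |
     <= (2 * C)%:E * Nf f * Ng g)%E.
Proof.
move=> mc mG d0 sep bf bg.
have p0 : 0 < p by apply: lt_trans p1.
have q0 : 0 < q by rewrite divr_gt0// subr_gt0.
have pq : p^-1 + q^-1 = 1.
  by rewrite /q invf_div -{1}[p^-1]mul1r -mulrDl addrC subrK divff// gt_eqF.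
pose A (S : {set T}) := G `&` [set x | c x \in S].
have mA S : measurable (A S) by exact: measurableI.
pose F S x := f x * \1_(A S) x.
pose H S x := g x * \1_(A (~: S)%SET) x.
have bF S : bdd_borel_cpt (F S) by exact: bdd_borel_cpt_restrict.
have bH S : bdd_borel_cpt (H S) by exact: bdd_borel_cpt_restrict.
pose m := (2 ^ #|T|)%:R : R.
have m0 : 0 < m by rewrite /m ltr0n expn_gt0.
have hS S : (`| \int[P]_z (K z.1 z.2 * F S z.2 * H S z.1)%:E |
    <= C%:E * Nf (F S) * Ng (H S))%E.
  rewrite -iterated_kernel_test//; apply: KC => //.
  (* A label in [S] differs from one outside [S], so the two pieces lie at distance at least [d] and
     the restricted bound applies. *)
  have [e e0 he] : pos_dist (closure (A S)) (closure (A (~: S)%SET)).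
    apply: pos_dist_closure; exists d => // x y [Gx /= xS] [Gy /=].
    rewrite inE => yS; apply: sep => //.
    by apply: contraNneq yS => <-.
  by exists e => // x y /supp_restrict[_ Ax] /supp_restrict[_ Ay]; exact: he.
have in_A S x : \1_(A S) x = \1_G x * (c x \in S)%:R :> R.
  rewrite /A indicI /=; congr (_ * _); rewrite indicE; congr (_%:R).
  by congr nat_of_bool; apply/idP/idP; rewrite inE.
have G1 x : \1_G x <= 1 :> R by rewrite indicE; case: (x \in G).
have G0 x : 0 <= \1_G x :> R by rewrite indicE.
(* A point of [G] lies in [A S] for exactly half of the sets [S], and a point outside [G] for none;
   hence [m / 2]. *)
have sF : \sum_S fine (Nf (F S)) `^ p <= m / 2 * fine (Nf f) `^ p.
  apply: sum_Lnorm_restrict => //; first by rewrite divr_ge0// ltW.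
  move=> x; under eq_bigr do rewrite in_A.
  rewrite -mulr_sumr -natr_sum -[leRHS]mul1r ler_pM// ler_pdivlMr//.
  by rewrite -natrM mulnC sum_in_set.
have sH : \sum_S fine (Ng (H S)) `^ q <= m / 2 * fine (Ng g) `^ q.
  apply: sum_Lnorm_restrict => //; first by rewrite divr_ge0// ltW.
  move=> x; under eq_bigr do rewrite in_A inE.
  rewrite -mulr_sumr -natr_sum -[leRHS]mul1r ler_pM// ler_pdivlMr//.
  by rewrite -natrM mulnC sum_notin_set.
have hoelder := sum_hoelder _ _ _ _ _ _ _ _ _ p0 q0 pq
  (fine_ge0 (Lnorm_ge0 mu p%:E (EFin \o f)))
  (fine_ge0 (Lnorm_ge0 nu q%:E (EFin \o g))) (divr_ge0 (ltW m0) (ler0n _ 2))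
  (fun S => fine_ge0 (Lnorm_ge0 mu p%:E _)) (fun S => fine_ge0 (Lnorm_ge0 nu q%:E _)) sF sH.
have iFH S : P.-integrable setT (fun z => (K z.1 z.2 * F S z.2 * H S z.1)%:E).
  exact: integrable_kernel_test.
(* Two distinct labels are split in the required order by [m / 4] of the sets, equal labels by none;
   hence the factor [4 / m]. *)
have -> : (\int[P]_z (K z.1 z.2 * f z.2 * g z.1 *
        (\1_G z.1 * \1_G z.2 * (c z.1 != c z.2)%:R))%:E =
   (4 / m)%:E * \sum_S \int[P]_z (K z.1 z.2 * F S z.2 * H S z.1)%:E)%E.
  rewrite -integral_sum// -integralZl//; last exact: integrable_sum.
  apply: eq_integral => z _; rewrite sumEFin -EFinM; congr (_%:E).
  have e S : K z.1 z.2 * F S z.2 * H S z.1 =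
      K z.1 z.2 * f z.2 * g z.1 * (\1_G z.1 * \1_G z.2) *
      ((c z.2 \in S) && (c z.1 \notin S))%:R.
    by rewrite /F /H !in_A inE -mulnb natrM; ring.
  under eq_bigr do rewrite e.
  rewrite -mulr_sumr -natr_sum.
  have <- : 4 / m * (\sum_(S : {set T}) ((c z.2 \in S) && (c z.1 \notin S)))%:R =
      (c z.1 != c z.2)%:R.
    have [czE|cz] := eqVneq (c z.1) (c z.2).
      by rewrite czE big1 ?mulr0// => S _; case: (c z.2 \in S).
    rewrite mulrAC -natrM sum_in_notin_set 1?eq_sym//.
    by rewrite divff// gt_eqF.
  by ring.
rewrite abseM gee0_abs ?lee_fin ?divr_ge0 ?(ltW m0)//.
have fNf f' : bdd_borel_cpt f' -> Nf f' = (fine (Nf f'))%:E.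
  by move=> ?; rewrite fineK// Lnorm_fin_num.
have fNg g' : bdd_borel_cpt g' -> Ng g' = (fine (Ng g'))%:E.
  by move=> ?; rewrite fineK// Lnorm_fin_num.
apply: (@le_trans _ _ ((4 / m)%:E * \sum_S C%:E * Nf (F S) * Ng (H S))%E).
  rewrite lee_pmul2l ?lte_fin ?divr_gt0//.
  by apply: le_trans (lee_abs_sum _ _ _) _; apply: lee_sum => S _; exact: hS.
rewrite (fNf f)// (fNg g)//.
under eq_bigr do rewrite fNf// fNg// -!EFinM.
rewrite sumEFin -!EFinM lee_fin.
under eq_bigr do rewrite -mulrA.
rewrite -mulr_sumr.
(* The factors [4 / m] and [m / 2] multiply to 2, the constant of the theorem. *)
apply: (@le_trans _ _ (4 / m * (C * (m / 2 * fine (Nf f) * fine (Ng g))))).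
  by rewrite ler_pM2l ?divr_gt0// ler_wpM2l.
rewrite le_eqVlt; apply/orP; left; apply/eqP; field.
by rewrite gt_eqF.
Qed.

(** Two limits in turn: for fixed [n] the slabs close as [k] grows, then the cells are refined by
    letting [n] grow. *)
Lemma kernel_form_bound f g : bdd_borel_cpt f -> bdd_borel_cpt g ->
  (`| \int[P]_z (K z.1 z.2 * f z.2 * g z.1)%:E |
     <= (2 * C)%:E * 'N[mu]_(p%:E)[EFin \o f] * 'N[nu]_((p / (p - 1))%:E)[EFin \o g])%E.
Proof.
move=> bf bg.
pose dc n (z : E * E) : R := (cell n z.1 != cell n z.2)%:R.
have mdc n : measurable_fun setT (dc n).
  (* Measurability: the pairs with equal labels form the finite union of the squares of the
     cells. *)
  rewrite (_ : dc n = \1_(~` \bigcup_(v in [set: {ffun 'I_N * 'I_n -> bool}])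
     ([set x | cell n x == v] `*` [set x | cell n x == v]))).
    apply: measurable_indic; apply: measurableC; apply: fin_bigcup_measurable.
      exact: finite_finset.
    by move=> v _; apply: measurableX; exact: (measurable_cell n (fun u => u == v)).
  apply/funext => z; rewrite indicE /dc; congr (_%:R); congr nat_of_bool.
  apply/idP/idP.
    by move=> zz; apply/mem_set => -[v _ /= [/eqP <-]]; rewrite eq_sym (negbTE zz).
  move/set_mem => h; apply/negP => /eqP zz; apply: h.
  by exists (cell n z.1) => //; split => /=; rewrite ?zz.
have dc1 n z : `|dc n z| <= 1 by rewrite /dc; case: (_ != _); rewrite ?normr1 ?normr0.
have h1 n : (`| \int[P]_z (K z.1 z.2 * f z.2 * g z.1 * dc n z)%:E |
     <= (2 * C)%:E * 'N[mu]_(p%:E)[EFin \o f] * 'N[nu]_((p / (p - 1))%:E)[EFin \o g])%E.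
  pose w_ k (z : E * E) : R := \1_(gapped n k) z.1 * \1_(gapped n k) z.2 * dc n z.
  apply: (kernel_bound_lim f g w_) => //.
  - move=> k; apply: measurable_funM => //; apply: measurable_funM.
      apply: (@measurableT_comp _ _ _ _ _ _ (\1_(gapped n k) : E -> R)) => //.
      by apply: measurable_indic; exact: measurable_gapped.
    apply: (@measurableT_comp _ _ _ _ _ _ (\1_(gapped n k) : E -> R)) => //.
    by apply: measurable_indic; exact: measurable_gapped.
  - move=> k z; rewrite /w_ !indicE.
    by case: (_ \in _); case: (_ \in _); rewrite /= ?mul1r ?mul0r ?normr0.
  - apply: aeW => z; near=> k.
    rewrite /w_ !indicE !mem_set ?mul1r//; near: k; exact: near_gapped.
  - move=> k; apply: (@separated_cells_bound _ (cell n) _ k.+1%:R^-1) => //.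
    + by move=> S; exact: (measurable_cell n (fun v => v \in S)).
    + exact: measurable_gapped.
    + by move=> x y; exact: gapped_dist.
under eq_integral do rewrite -[_ * g _]mulr1.
apply: (kernel_bound_lim f g dc (cst 1)) => //.
(* Off the diagonal the weight is eventually 1, and the diagonal is null. *)
exists [set z : E * E | z.1 = z.2]; split.
- exact: measurable_diagonal.
- exact: diagonal_null.
- move=> z /= nz; apply: contrapT => /eqP zz; apply: nz.
  near=> n; rewrite /dc.
  by have -> : cell n z.1 != cell n z.2 by near: n; exact: near_cell_neq.
Unshelve. all: by end_near. Qed.

(** * Duality: from the form to the operator *)

Variable f : E -> R.
Hypothesis bf : bdd_borel_cpt f.

(** Fubini for the form tested against the indicator of each box; countably many boxes cover the
    space. *)
Lemma ae_integrable_kernel :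
  {ae nu, forall s, mu.-integrable setT (fun t => (K s t * f t)%:E)}.
Proof.
have b1 n : bdd_borel_cpt (\1_(box n%:R) : E -> R).
  apply: (@bdd_borel_cpt_sub_box _ _ _ 1 n%:R).
  - by apply: measurable_indic; apply: measurable_compact_RN; exact: compact_box.
  - by move=> x; rewrite indicE; case: (_ \in _); rewrite ?normr1 ?normr0.
  - by move=> x; rewrite indicE pnatr_eq0 eqb0 negbK => /set_mem.
have /ae_foralln := fun n => ae_integrable1 (integrable_kernel_test _ _ bf (b1 n)).
apply: filterS => s /= h; have [n0 /(_ n0 (leqnn _)) sn] := box_cover s.
have := h n0; rewrite indicE mem_set//.
by under [X in _.-integrable _ X]eq_fun do rewrite mulr1.
Qed.

(** The integral is the difference of the integrals of the positive and negative parts, each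
    measurable in [s] by Tonelli. This covers also the points [s] at which the integrand is not
    integrable. *)
Lemma measurable_intop : measurable_fun setT (fun s : E => intop mu K f s).
Proof.
have mKf : measurable_fun setT (fun z : E * E => (K z.1 z.2 * f z.2)%:E).
  have [mK _] := KL2; have [mf _ _] := bf.
  apply/measurable_EFinP; apply: measurable_funM => //.
  exact: (measurableT_comp mf).
have h1 := measurable_fun_fubini_tonelli_F (m2 := mu) _
  (measurable_funepos mKf) (funepos_ge0 _).
have h2 := measurable_fun_fubini_tonelli_F (m2 := mu) _
  (measurable_funeneg mKf) (funeneg_ge0 _).
apply: eq_measurable_fun (emeasurable_funB h1 h2) => s _.
by rewrite /intop [RHS]integralE /fubini_F !unlock.
Qed.

Lemma ae_intop_fin_num : {ae nu, forall s, intop mu K f s \is a fin_num}.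
Proof.
by apply: filterS ae_integrable_kernel => s; exact: integrable_fin_num.
Qed.

(** Cutting down to this set makes the dual test function bounded with compact support; the sets
    increase to almost all of the space. *)
Definition small_set n : set E :=
  [set s | box n%:R s /\ (`|intop mu K f s| <= n%:R%:E)%E].

Lemma measurable_small_set n : measurable (small_set n).
Proof.
apply: measurableI; first by apply: measurable_compact_RN; exact: compact_box.
have m : measurable_fun setT (fun s => `|intop mu K f s| <= n%:R%:E)%E.
  by apply: measurable_fun_lee => //; apply: measurableT_comp => //; exact: measurable_intop.
by have := m measurableT [set true] I; rewrite setTI.
Qed.

Lemma small_set_fin_num n s : small_set n s -> intop mu K f s = (fine (intop mu K f s))%:E.
Proof.
by move=> [_ h]; rewrite fineK// fin_num_abs; apply: le_lt_trans h _; rewrite ltry.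
Qed.

(* Testing the form against |Tf|^(p-2) Tf, truncated where Tf is large. *)
Lemma integral_small_set_le n :
  (\int[nu]_(s in small_set n) `|intop mu K f s| `^ p <=
     ((2 * C * fine 'N[mu]_(p%:E)[EFin \o f]) `^ p)%:E)%E.
Proof.
set a := fine _.
have p0 : 0 < p by apply: lt_trans p1.
have p10 : 0 < p - 1 by rewrite subr_gt0.
have q0 : 0 < q by rewrite divr_gt0.
pose u s := fine (intop mu K f s).
have mu' : measurable_fun setT u.
  by apply: (@measurableT_comp _ _ _ _ _ _ fine) => //; exact: measurable_intop.
(* The exponent is $p - 2$, possibly negative. The factor [u s] makes $|g| = |u|^{p-1}$ hold also
   where [u] vanishes. *)
pose g s := u s * `|u s| `^ (p - 1 - 1) * \1_(small_set n) s.
have gE s : `|g s| = `|u s| `^ (p - 1) * \1_(small_set n) s.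
  rewrite /g !normrM (ger0_norm (powR_ge0 _ _)) mulr_powRB1//.
  by rewrite [`|\1_ _ _|]ger0_norm.
have bg : bdd_borel_cpt g.
  apply: (@bdd_borel_cpt_sub_box _ _ _ (n%:R `^ (p - 1)) n%:R).
  - apply: measurable_funM; last by apply: measurable_indic; exact: measurable_small_set.
    apply: measurable_funM => //; apply: (measurableT_comp (measurable_powR _)).
    exact: measurableT_comp.
  - move=> s; rewrite gE indicE.
    have [/set_mem sn|_] := boolP (s \in small_set n); last by rewrite mulr0 powR_ge0.
    rewrite mulr1 ge0_ler_powR ?nnegrE ?(ltW p10)//.
    by have [_] := sn; rewrite (small_set_fin_num _ _ sn) lee_fin.
  - move=> s; rewrite mulf_eq0 negb_or indicE pnatr_eq0 eqb0 negbK => /andP[_ /set_mem].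
    by case.
set I := (\int[nu]_(s in _) _)%E.
have IE : I = (\int[nu]_s (`|u s| `^ p * \1_(small_set n) s)%:E)%E.
  rewrite /I integral_mkcond; apply: eq_integral => s _.
  rewrite patchE indicE; case: ifPn => [/set_mem sn|_]; last by rewrite mulr0.
  by rewrite mulr1 (small_set_fin_num _ _ sn).
(* Because $(p - 1) q = p$. *)
have Ng : ('N[nu]_(q%:E)[EFin \o g] `^ q = I)%E.
  rewrite poweR_Lnorm ?gt_eqF// IE; apply: eq_integral => s _.
  rewrite /= gE indicE; case: (_ \in _).
    by rewrite !mulr1 -powRrM mulrC divfK ?gt_eqF.
  by rewrite !mulr0 powR0// gt_eqF.
(* The truncation pays here: a finite norm of [g] can be divided out at the end. *)
have Nfin := Lnorm_fin_num _ rnu _ _ q0 bg.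
have form : (\int[P]_z (K z.1 z.2 * f z.2 * g z.1)%:E)%E = I.
  rewrite -integral12_prod_meas1; last exact: integrable_kernel_test.
  rewrite IE; apply: ae_eq_integral => //.
  - exact: (measurable_fubini_F (integrable_kernel_test _ _ bf bg)).
  - apply/measurable_EFinP; apply: measurable_funM; last first.
      by apply: measurable_indic; exact: measurable_small_set.
    apply: (measurableT_comp (measurable_powR _)); exact: measurableT_comp.
  (* Where the inner integrand is integrable, [g s] comes out of the integral and multiplies
     $Tf(s)$, giving $|u|^p$ on the small set. *)
  apply: filterS ae_integrable_kernel => s ints _; rewrite /fubini_F /=.
  under eq_integral do rewrite EFinM.
  rewrite integralZr// -/(intop mu K f s) /g indicE.
  have [/set_mem sn|_] := boolP (s \in small_set n); last by rewrite !mulr0 mule0.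
  rewrite (small_set_fin_num _ _ sn) -/(u s) -EFinM !mulr1 mulrA; congr (_%:E).
  rewrite -expr2 -real_normK ?num_real// expr2 -mulrA mulr_powRB1//.
  by rewrite mulr_powRB1.
have := kernel_form_bound f g bf bg.
rewrite form -/q.
set b := fine 'N[nu]_(q%:E)[EFin \o g].
have Nb : ('N[nu]_(q%:E)[EFin \o g] = b%:E)%E by rewrite fineK.
have b0 : 0 <= b by apply: fine_ge0; exact: Lnorm_ge0.
have a0 : 0 <= a by apply: fine_ge0; exact: Lnorm_ge0.
have Na : ('N[mu]_(p%:E)[EFin \o f] = a%:E)%E by rewrite fineK// Lnorm_fin_num.
move: Ng; rewrite Nb Na poweR_EFin => <-.
rewrite abse_EFin (ger0_norm (powR_ge0 _ _)) -!EFinM !lee_fin => h.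
have [b00|bn0] := eqVneq b 0; first by rewrite b00 powR0 ?powR_ge0// gt_eqF.
have {}b0 : 0 < b by rewrite lt_neqAle eq_sym bn0.
(* The bound now reads $b^q \le 2C a b$. Dividing by [b] and raising to the power [p] gives the
   claim, since $(q - 1) p = q$. *)
have -> : b `^ q = (b `^ (q - 1)) `^ p.
  rewrite -powRrM; congr (_ `^ _); rewrite /q.
  by field; rewrite gt_eqF.
rewrite ge0_ler_powR ?nnegrE ?powR_ge0 ?(ltW p0) ?mulr_ge0//.
by rewrite -(ler_pM2l b0) mulr_powRB1 ?(ltW b0)// mulrC.
Qed.

(** Monotone convergence of the truncated bounds, whose right-hand side is independent of [n]. *)
Lemma Lnorm_intop_le :
  ('N[nu]_(p%:E)[intop mu K f] <= (2 * C)%:E * 'N[mu]_(p%:E)[EFin \o f])%E.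
Proof.
have p0 : 0 < p by apply: lt_trans p1.
rewrite -[X in (_ <= _ * X)%E]fineK ?Lnorm_fin_num// -EFinM.
set c := _ * _.
have c0 : 0 <= c by rewrite !mulr_ge0// fine_ge0// Lnorm_ge0.
have mT : measurable_fun setT (fun s => `|intop mu K f s| `^ p)%E.
  apply: (@measurableT_comp _ _ _ _ _ _ (fun x => x `^ p)%E) => //.
    exact: measurable_poweR.
  by apply: measurableT_comp => //; exact: measurable_intop.
suff : (\int[nu]_s `|intop mu K f s| `^ p <= (c `^ p)%:E)%E.
  move=> h; rewrite unlock.
  apply: (@le_trans _ _ ((c `^ p)%:E `^ p^-1)%E).
    apply: gt0_ler_poweR => //; rewrite ?invr_ge0 ?(ltW p0)//.
      by rewrite in_itv /= leey andbT integral_ge0// => s _; rewrite poweR_ge0.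
    by rewrite in_itv /= leey andbT lee_fin powR_ge0.
  by rewrite poweR_EFin -powRrM divff ?powRr1// gt_eqF.
have mS := measurable_small_set.
pose S := \bigcup_n small_set n.
have mSS : measurable S by exact: bigcupT_measurable.
(* A point in none of the small sets has infinite [intop], which happens only on a [nu]-null set. *)
rewrite (@ge0_negligible_integral _ _ _ _ _ (~` S))//; first last.
- apply/negligibleP; first exact: measurableC.
  apply: negligibleS ae_intop_fin_num => s /= nS fs; apply: nS.
  have [n0 hn0] := box_cover s.
  exists (maxn n0 (Num.trunc `|fine (intop mu K f s)|).+1) => //; split.
    by apply: hn0; rewrite leq_maxl.
  rewrite -[intop mu K f s]fineK// lee_fin; apply: le_trans (ltW (truncnS_gt _)) _.
  by rewrite ler_nat leq_maxr.
- by move=> s _; rewrite poweR_ge0.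
- exact: measurableC.
rewrite setDE setTI setCK.
have cv : (\int[nu]_(s in small_set n) `|intop mu K f s| `^ p)%E @[n --> \oo] -->
    (\int[nu]_(s in S) `|intop mu K f s| `^ p)%E.
  apply: ge0_nondecreasing_set_cvg_integral => //.
  - move=> n m nm; apply/subsetPset => s [sn hn]; split.
      by move=> j; apply: le_trans (sn j) _; rewrite ler_nat.
    by apply: le_trans hn _; rewrite lee_fin ler_nat.
  - by move=> n; exact: measurable_funTS.
  - by move=> n s _; rewrite poweR_ge0.
by apply: cvge_le cv; apply: nearW => n; exact: integral_small_set_le.
Qed.

End kernel.

Theorem theorem3p4 (R : realType) (N : nat) (p : R)
    (mu : {sigma_finite_measure set RN R N -> \bar R})
    (nu : {measure set RN R N -> \bar R})
    (K : RN R N -> RN R N -> R) (C : R) :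
  1 < p -> radon mu -> radon nu -> no_common_atoms mu nu ->
  L2loc mu nu K -> 0 <= C -> restrictedly_Lp_bounded p mu nu K C ->
  forall f : RN R N -> R, bdd_borel_cpt f ->
    [/\ {ae nu, forall s, mu.-integrable setT (fun t => (K s t * f t)%:E)},
        measurable_fun setT (fun s : RN R N => intop mu K f s)
      & ('N[nu]_(p%:E)[intop mu K f] <= (2 * C)%:E * 'N[mu]_(p%:E)[EFin \o f])%E].
Proof.
move=> p1 rmu rnu nca KL2 C0 KC f bf.
(* From here on [nu] is replaced by its sigma-finite copy in all hypotheses. *)
have [nu' nu'E] := sigma_finite_measure_of _ _ _ _ (radon_sigma_finite _ _ _ rnu).
case: nu / nu'E in rnu nca KL2 KC *.
split.
- exact: ae_integrable_kernel.
- exact: (measurable_intop _ _ _ KL2 _ bf).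
- exact: Lnorm_intop_le.
Qed.
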